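(* Let $\mathcal{H}$ be a finite-dimensional complex Hilbert space, let $A\in\mathbb{B}(\mathcal{H})$ be a positive operator, and let $T,S\in\mathbb{B}_{A^{1/2}}(\mathcal{H})$. Then the following conditions are equivalent: (i) There exists $x\in\mathbb{M}^T_A$ such that $Tx\perp_A Sx$, i.e. there exists $x\in\mathcal{H}$ with $\|x\|_A=1$, $\|Tx\|_A=\|T\|_A$ and $\langle Tx,Sx\rangle_A=0$. (ii) $T\perp^B_A S$, i.e. $\|T+\gamma S\|_A\ge\|T\|_A$ for all $\gamma\in\mathbb{C}$.
   Context: $\mathbb{B}(\mathcal{H})$ denotes the bounded linear operators on the complex Hilbert space $(\mathcal{H},\langle\cdot,\cdot\rangle)$. An operator $A\in\mathbb{B}(\mathcal{H})$ is positive if $\langle Ax,x\rangle\ge 0$ for all $x\in\mathcal{H}$. Put $\langle x,y\rangle_A=\langle Ax,y\rangle$ and $\|x\|_A=\sqrt{\langle x,x\rangle_A}$ (a seminorm); $x\perp_A y$ means $\langle x,y\rangle_A=0$. $\mathbb{B}_{A^{1/2}}(\mathcal{H})$ is the set of $T\in\mathbb{B}(\mathcal{H})$ for which there is $c>0$ with $\|Tx\|_A\le c\|x\|_A$ for all $x\in\mathcal{H}$. For such $T$, $\|T\|_A=\sup\{\|Tx\|_A/\|x\|_A:\ x\in\overline{\mathcal{R}(A)},\ x\ne 0\}=\inf\{c>0:\ \|Tx\|_A\le c\|x\|_A \text{ for all } x\in\mathcal{H}\}$, where $\overline{\mathcal{R}(A)}$ is the norm closure of the range of $A$; also $\|T\|_A=\sup\{\|Tx\|_A:\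 x\in\mathcal{H},\ \|x\|_A=1\}$. Finally $\mathbb{M}^T_A=\{x\in\mathcal{H}:\ \|x\|_A=1,\ \|Tx\|_A=\|T\|_A\}$.
   Formalization: The formal theorem assumes A ≠ 0; for A = 0 the equivalence fails, since no x has ‖x‖_A = 1, so (i) is false, while all A-norms of operators are 0, so (ii) is true. *)

(* Defs.v *)
From mathcomp Require Import all_boot all_order all_algebra.
From mathcomp Require Import complex.
From mathcomp Require Import classical_sets reals.

Set Implicit Arguments.
Unset Strict Implicit.
Unset Printing Implicit Defensive.

Import Order.TTheory GRing.Theory Num.Theory Num.Def.

Local Open Scope classical_set_scope.
Local Open Scope ring_scope.

(* A finite-dimensional complex Hilbert space is a [vectType] [H] over [R[i]]
   with a positive definite Hermitian form [dot : {dot H for conjC}], linear in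
   its first argument and conjugate-linear in its second.  Every linear
   endomorphism is then bounded, so B(H) is ['End(H)]. *)

Definition positive_op (R : realType) (H : vectType R[i])
    (dot : {dot H for conjC}) (A : 'End(H)) : Prop :=
  forall x : H, 0 <= dot (A x) x.

Definition dotA (R : realType) (H : vectType R[i])
    (dot : {dot H for conjC}) (A : 'End(H)) (x y : H) : R[i] :=
  dot (A x) y.

(* For positive [A] the complex number [<x, x>_A] is real, so that taking the
   real part only changes its type. *)
Definition normA (R : realType) (H : vectType R[i])
    (dot : {dot H for conjC}) (A : 'End(H)) (x : H) : R :=
  Num.sqrt (complex.Re (dotA dot A x x)).

Definition norm_dot (R : realType) (H : vectType R[i])
    (dot : {dot H for conjC}) (x : H) : R :=
  Num.sqrt (complex.Re (dot x x)).

Definition perpA (R : realType) (H : vectType R[i])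
    (dot : {dot H for conjC}) (A : 'End(H)) (x y : H) : Prop :=
  dotA dot A x y = 0.

Definition boundedA (R : realType) (H : vectType R[i])
    (dot : {dot H for conjC}) (A : 'End(H)) : set 'End(H) :=
  [set T | exists2 c : R, 0 < c &
    forall x : H, normA dot A (T x) <= c * normA dot A x].

Definition closure_range (R : realType) (H : vectType R[i])
    (dot : {dot H for conjC}) (A : 'End(H)) : set H :=
  [set y | forall e : R, 0 < e -> exists z : H, norm_dot dot (y - A z) < e].

(* [sup] is real-valued and equals 0 on empty or unbounded sets; the set below
   is nonempty when [A != 0] and bounded above when [boundedA dot A T]. *)
Definition opnormA (R : realType) (H : vectType R[i])
    (dot : {dot H for conjC}) (A T : 'End(H)) : R :=
  sup [set normA dot A (T x) / normA dot A x
      | x in [set x | closure_range dot A x /\ x != 0]].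

Definition norm_attainA (R : realType) (H : vectType R[i])
    (dot : {dot H for conjC}) (A T : 'End(H)) : set H :=
  [set x | normA dot A x = 1 /\ normA dot A (T x) = opnormA dot A T].

Definition bj_perpA (R : realType) (H : vectType R[i])
    (dot : {dot H for conjC}) (A T S : 'End(H)) : Prop :=
  forall g : R[i], opnormA dot A T <= opnormA dot A (T + g *: S).

(* Main.v *)
(* Put N x = <x,x>_A, a x = |Tx|_A^2, b x = <Tx,Sx>_A, and let lam = |T|_A^2 be
   the maximum of a / N.  The set M = {a = lam N} is the null space of the
   positive form lam N - a, hence a subspace.
   If (ii) holds, let x0 minimize |b| on the A-unit vectors of M, with
   w = b x0.  The convexity argument of Toeplitz and Hausdorff (along the plane
   spanned by x0 and x the numerical range of b contains a segment issued from
   w in the direction of b x) shows Re (w^* b x) >= |w|^2 N x on M.  If w <> 0,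
   then by compactness Re (w^* b) > |w|^2 N / 2 near M while lam N - a is
   bounded below away from M, so that |T - t w S|_A < |T|_A for small t > 0,
   against (ii).
   The seminorm only matters modulo its kernel, of which the range of A is a
   complement; all extrema are taken on the unit sphere of real coordinates of
   that range. *)
Require Import Defs.
From mathcomp Require Import all_boot all_order all_algebra.
From mathcomp Require Import complex.
From mathcomp Require Import classical_sets reals.
From mathcomp Require Import boolp functions topology normedtype derive realfun.
From mathcomp Require Import ring lra.

Set Implicit Arguments.
Unset Strict Implicit.
Unset Printing Implicit Defensive.

Import Order.TTheory GRing.Theory Num.Theory Num.Def.
Import numFieldNormedType.Exports.

Local Open Scope ring_scope.

Local Notation RE := complex.Re.
Local Notation IM := complex.Im.

(** A predicate on bare functions, so that derived forms such as [N (P x) (Q y)] or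
    [B x y - w * N x y] are covered without a bundled structure. *)
Record sesqui_form (R : rcfType) (H : lmodType R[i]) (B : H -> H -> R[i]) :
    Prop := SesquiForm {
  sesquiDl : forall x y z, B (x + y) z = B x z + B y z;
  sesquiDr : forall x y z, B z (x + y) = B z x + B z y;
  sesquiZl : forall c x y, B (c *: x) y = c * B x y;
  sesquiZr : forall c x y, B x (c *: y) = c^* * B x y }.

(** * Real and imaginary parts of complex numbers *)

Section ComplexParts.
Variable R : rcfType.
Implicit Types z w : R[i].
Lemma ReM z w : RE (z * w) = RE z * RE w - IM z * IM w.
Proof. by case: z w => a b [c d]. Qed.
Lemma ImM z w : IM (z * w) = RE z * IM w + IM z * RE w.
Proof. by case: z w => a b [c d]. Qed.
Lemma ReD z w : RE (z + w) = RE z + RE w.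
Proof. by case: z w => a b [c d]. Qed.
Lemma ImD z w : IM (z + w) = IM z + IM w.
Proof. by case: z w => a b [c d]. Qed.
Lemma ReN z : RE (- z) = - RE z.
Proof. by case: z. Qed.
Lemma ImN z : IM (- z) = - IM z.
Proof. by case: z. Qed.
Lemma ReJ z : RE (z^*) = RE z.
Proof. by case: z. Qed.
Lemma ImJ z : IM (z^*) = - IM z.
Proof. by case: z. Qed.
Lemma ReC (r : R) : RE (r%:C)%C = r. Proof. by []. Qed.
Lemma ImC (r : R) : IM (r%:C)%C = 0. Proof. by []. Qed.
Lemma eqRI z w : RE z = RE w -> IM z = IM w -> z = w.
Proof. by case: z w => a b [c d] /= -> ->. Qed.
Lemma Re_i : RE ('i : R[i])%C = 0. Proof. by []. Qed.
Lemma Im_i : IM ('i : R[i])%C = 1. Proof. by []. Qed.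
Lemma Re_1 : RE (1 : R[i]) = 1. Proof. by []. Qed.
Lemma Im_1 : IM (1 : R[i]) = 0. Proof. by []. Qed.
Definition ReImE :=
  (Re_i, Im_i, Re_1, Im_1, ReM, ImM, ReD, ImD, ReN, ImN, ReJ, ImJ, ReC, ImC).

(** For [b] equal to p-bar minus q the sum is |p|^2 - |q|^2, hence real. When this [b] is zero,
    [b = 1] serves. Passing to [- b] corrects the sign. *)
Lemma exists_phase (p q : R[i]) : exists2 b, b != 0 & 0 <= b * p + b^* * q.
Proof.
suff [b b0 Hb] : exists2 b, b != 0 & IM (b * p + b^* * q) = 0.
  have [s|s] := leP 0 (RE (b * p + b^* * q)).
    by exists b => //; rewrite lecE Hb s eqxx.
  exists (- b); first by rewrite oppr_eq0.
  rewrite rmorphN !mulNr -opprD lecE ImN ReN Hb oppr0 eqxx /= oppr_ge0; exact: ltW.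
have [D0|D0] := eqVneq p (q^*).
  exists 1; first exact: oner_neq0.
  by rewrite D0 !ReImE /=; ring.
exists ((p - q^*)^*); first by rewrite conjC_eq0 subr_eq0.
by rewrite !ReImE; ring.
Qed.
End ComplexParts.

(** * Sesquilinear forms and the convexity argument *)

Section Forms.
Variables (R : rcfType) (H : lmodType R[i]).
Implicit Types (B N : H -> H -> R[i]) (x y z : H).

Definition psd B := forall x, 0 <= B x x.
Definition qform B x : R := RE (B x x).

Lemma psd_qform_ge0 B x : psd B -> 0 <= qform B x.
Proof. by move=> /(_ x); rewrite lecE => /andP[]. Qed.

Lemma psd_Im B x : psd B -> IM (B x x) = 0.
Proof. by move=> /(_ x); rewrite lecE => /andP[/eqP]. Qed.

Lemma psd_real B x : psd B -> B x x = (qform B x)%:C%C.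
Proof. by move=> pB; apply: eqRI; rewrite ?ImC ?psd_Im. Qed.

Lemma sesqui_expand B (c : R[i]) x y : sesqui_form B ->
  B (x + c *: y) (x + c *: y) =
  B x x + (c * B y x + c^* * B x y) + c * c^* * B y y.
Proof. by move=> [Dl Dr Zl Zr]; rewrite !(Dl, Dr, Zl, Zr); ring. Qed.

(** Polarization: reality of the form at x + y and at x + iy settles the imaginary and the real part
    of the cross terms respectively. *)
Lemma psd_herm B : sesqui_form B -> psd B -> forall x y, B y x = (B x y)^*.
Proof.
move=> sB pB x y.
have := psd_Im (x + 1 *: y) pB; have := psd_Im (x + 'i%C *: y) pB.
rewrite !(sesqui_expand _ _ _ sB) !ReImE !psd_Im // => h1 h2.
by apply: eqRI; rewrite !ReImE; lra.
Qed.

Lemma psd_null B z : sesqui_form B -> psd B -> qform B z = 0 ->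
  forall y, B z y = 0 /\ B y z = 0.
Proof.
move=> sB pB z0 y; suff w0 : B z y = 0 by rewrite (psd_herm sB pB z y) w0 conjC0.
have Bzz : B z z = 0 by rewrite psd_real // z0.
set w := B z y; have yz : B y z = w^* by exact: psd_herm.
set n := RE w ^+ 2 + IM w ^+ 2.
have [n0|n0] := eqVneq n 0.
  by apply: eqRI => /=; move: n0 => /eqP;
     rewrite paddr_eq0 ?sqr_ge0 // !sqrf_eq0 => /andP[/eqP ? /eqP ?].
(* At y minus s times w-bar times z the form is [qform B y - 2 * s * n]; this [s] turns it into
   [- qform B y - 2], which is negative. *)
pose s : R := (qform B y + 1) / n.
have := psd_qform_ge0 (y + (- (s%:C%C * w^*)) *: z) pB.
have := psd_qform_ge0 y pB.
rewrite {2}/qform (sesqui_expand _ _ _ sB) Bzz yz -/w !ReImE.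
have -> : RE (B y y) = qform B y by [].
move=> q0; set e := (X in 0 <= X -> _).
have -> : e = qform B y - 2 * s * n by rewrite /e /n /=; ring.
move=> e0; exfalso; have sn : s * n = qform B y + 1 by rewrite divfK.
move: e0; rewrite -mulrA sn; lra.
Qed.

Lemma psd_nullD B : sesqui_form B -> psd B -> forall x z, qform B z = 0 ->
  qform B (x + z) = qform B x.
Proof.
move=> sB pB x z z0; have [h _] := psd_null sB pB z0 z.
have [h1 h2] := psd_null sB pB z0 x.
by rewrite /qform !(sesquiDl sB, sesquiDr sB) h h1 h2 !addr0.
Qed.

Lemma qformZ B (c : R[i]) x : sesqui_form B ->
  qform B (c *: x) = RE (c * c^* * B x x).
Proof. by move=> sB; rewrite /qform (sesquiZl sB) (sesquiZr sB) mulrA. Qed.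

Lemma sesqui_sub_scale B N (w : R[i]) :
  sesqui_form B -> sesqui_form N -> sesqui_form (fun x y => B x y - w * N x y).
Proof.
move=> [a1 a2 a3 a4] [b1 b2 b3 b4]; split=> *;
  rewrite ?(a1,a2,a3,a4,b1,b2,b3,b4); ring.
Qed.

(** The phase [b] makes the cross terms a nonnegative real multiple [k] of [B x x], so along the
    real line in direction [b *: x] the values leave 0 on the ray through [B x x]. *)
Lemma sesqui_segment B x0 x : sesqui_form B -> B x0 x0 = 0 -> B x x != 0 ->
  exists (b : R[i]) (k m : R), [/\ 0 <= k, 0 < m & forall r : R,
   B (x0 + (r%:C%C * b) *: x) (x0 + (r%:C%C * b) *: x) =
   (k * r + m * r ^+ 2)%:C%C * B x x].
Proof.
move=> sB B0 v0; set v := B x x.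
have [b b0 kb] := exists_phase (B x x0 / v) (B x0 x / v).
exists b, (RE (b * (B x x0 / v) + b^* * (B x0 x / v))), (RE (b * b^*)); split.
- by move: kb; rewrite lecE => /andP[].
- have := mul_conjC_gt0 b; rewrite b0 ltcE => /andP[_]; done.
move=> r; rewrite sesqui_expand // B0 add0r.
set K := _ + _ in kb *.
have real_coefs (z w : R[i]) : IM z = 0 ->
    (RE z * r + RE (w * w^*) * r ^+ 2)%:C%C = z * r%:C%C + w * w^* * r%:C%C ^+ 2.
  by move=> z0; rewrite !expr2; apply: eqRI; rewrite !ReImE z0; ring.
rewrite (real_coefs _ _ (ger0_Im kb)).
have rJ : (r%:C%C)^* = r%:C%C by apply: eqRI; rewrite !ReImE ?oppr0.
by rewrite [(r%:C%C * b)^*]rmorphM /= rJ -/v /K; field.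
Qed.

(** The limit r -> 0 made explicit: for r <= 1 the two last terms sum to at most (|c1| + |c2|) r,
    and the chosen [r] keeps this below - d0 / 2. *)
Lemma ge0_of_quadratic (d0 c1 c2 : R) :
  (forall r : R, 0 < r -> 0 <= d0 + c1 * r + c2 * r ^+ 2) -> 0 <= d0.
Proof.
move=> h; rewrite leNgt; apply/negP => k0.
pose c := `|c1| + `|c2| + 1; pose r := Num.min 1 (- d0 / (2 * c)).
have c0 : 0 < c by rewrite /c ltr_wpDl // addr_ge0.
have r0 : 0 < r by rewrite lt_min ltr01 /= divr_gt0 ?oppr_gt0 // mulr_gt0.
have r1 : r <= 1 by rewrite ge_min lexx.
have rc : r * (2 * c) <= - d0 by rewrite -ler_pdivlMr ?mulr_gt0 // ge_min lexx orbT.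
have := h r r0.
have l1 : c1 * r <= `|c1| * r by rewrite ler_pM2r // ler_norm.
have l2 : c2 * r ^+ 2 <= `|c2| * r.
  apply: (@le_trans _ _ (`|c2| * r ^+ 2)); first by rewrite ler_pM2r ?exprn_gt0 // ler_norm.
  by rewrite ler_wpM2l // expr2 -[leRHS]mulr1 ler_pM2l.
move: rc; rewrite /c; set a := `|c1| in l1 *; set b := `|c2| in l2 *; move=> rc.
have : a * r + b * r <= r * (2 * (a + b + 1)) / 2 by lra.
lra.
Qed.

Definition sqmod (z : R[i]) : R := RE z ^+ 2 + IM z ^+ 2.

(** First-order optimality. The form [B - w N] vanishes at [x0], so by the segment lemma [B y y] is
    w q + s v with q = N y and a small s > 0. Expanding its squared modulus, dividing by s and
    letting r tend to 0 gives the sign of the real part of w-bar v. The minimality hypothesis is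
    homogeneous, so [y] need not be normalized. *)
Lemma min_sqmod_Re B N x0 x (E : H -> Prop) :
  sesqui_form B -> sesqui_form N -> psd N ->
  (forall c, E (x0 + c *: x)) -> qform N x0 = 1 ->
  (forall y, E y -> sqmod (B x0 x0) * qform N y ^+ 2 <= sqmod (B y y)) ->
  sqmod (B x0 x0) * qform N x <= RE ((B x0 x0)^* * B x x).
Proof.
move=> sB sN pN Ex N1 min; set w := B x0 x0.
pose B' y z := B y z - w * N y z.
have sB' : sesqui_form B' by apply: sesqui_sub_scale.
have B'0 : B' x0 x0 = 0 by rewrite /B' (psd_real x0 pN) N1 mulr1 subrr.
suff : 0 <= RE (w^* * B' x x).
  rewrite /B' (psd_real x pN) /sqmod !ReImE; lra.
have [->|v0] := eqVneq (B' x x) 0; first by rewrite mulr0.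
have [b [k [m [k0 m0 h]]]] := sesqui_segment sB' B'0 v0.
set v := B' x x in v0 h *; set ka := RE _.
pose n1 := RE (b * N x x0 + b^* * N x0 x).
pose n2 := RE (b * b^*) * qform N x.
apply: (@ge0_of_quadratic _ (n1 * ka + k * sqmod v / 2) (n2 * ka + m * sqmod v / 2)) => r r0.
have := min _ (Ex (r%:C%C * b)).
set y := x0 + _.
have NE : qform N y = 1 + n1 * r + n2 * r ^+ 2.
  by rewrite /qform sesqui_expand // (psd_real x0 pN) N1 (psd_real x pN) /n1 /n2 !ReImE; ring.
have -> : B y y = w * (qform N y)%:C%C + (k * r + m * r ^+ 2)%:C%C * v.
  by rewrite -h -/y /B' (psd_real y pN); ring.
set s := _ + m * _; set q := qform N y.
have s0 : 0 < s by rewrite /s ltr_wpDl ?mulr_ge0 ?(ltW r0) // mulr_gt0 // exprn_gt0.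
have -> : sqmod (w * q%:C%C + s%:C%C * v) =
    sqmod w * q ^+ 2 + s * (2 * q * ka + s * sqmod v).
  by rewrite /sqmod /ka !ReImE; ring.
rewrite lerDl pmulr_rge0 // /q NE /s; lra.
Qed.

End Forms.

(** * Extrema of homogeneous functions by compactness *)

Section Compactness.
Variables (R : realType) (H : lmodType R[i]).
Implicit Types (F G : H -> R) (B : H -> H -> R[i]).

(** Real coordinates carry extremal problems on [H] to row vectors over [R], where closed bounded
    sets are compact. *)
Definition real_comb m (f : 'I_m -> H) (u : 'rV[R]_m) : H :=
  \sum_k (u 0 k)%:C%C *: f k.

Lemma real_combZ m (f : 'I_m -> H) (r : R) u :
  real_comb f (r *: u) = (r%:C)%C *: real_comb f u.
Proof.
by rewrite /real_comb scaler_sumr; apply: eq_bigr => k _; rewrite mxE rmorphM scalerA.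
Qed.

Lemma sesqui0 B x : sesqui_form B -> B 0 x = 0 /\ B x 0 = 0.
Proof.
by move=> sB; rewrite -(scale0r (0 : H)) (sesquiZl sB) (sesquiZr sB) conjC0 !mul0r.
Qed.

Lemma sesqui_real_comb B m (f : 'I_m -> H) u : sesqui_form B ->
  B (real_comb f u) (real_comb f u) =
  \sum_k \sum_l ((u 0 k * u 0 l)%:C)%C * B (f k) (f l).
Proof.
move=> sB; rewrite {1}/real_comb.
have Suml y : B (\sum_k (u 0 k)%:C%C *: f k) y = \sum_k (u 0 k)%:C%C * B (f k) y.
  elim/big_rec2: _ => [|k a b _ <-]; first by have [-> _] := sesqui0 y sB.
  by rewrite (sesquiDl sB) (sesquiZl sB).
rewrite Suml; apply: eq_bigr => k _; rewrite /real_comb.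
have -> : B (f k) (\sum_l (u 0 l)%:C%C *: f l) = \sum_l (u 0 l)%:C%C * B (f k) (f l).
  elim/big_rec2: _ => [|l a b _ <-]; first by have [_ ->] := sesqui0 (f k) sB.
  rewrite (sesquiDr sB) (sesquiZr sB); congr (_ * _ + _).
  by apply: eqRI; rewrite !ReImE ?oppr0.
by rewrite mulr_sumr; apply: eq_bigr => l _; rewrite rmorphM mulrA.
Qed.

Lemma Re_sum I (r : seq I) (h : I -> R[i]) :
  RE (\sum_(i <- r) h i) = \sum_(i <- r) RE (h i).
Proof. by elim/big_rec2: _ => [|i a b _ <-]; rewrite ?ReD. Qed.
Lemma Im_sum I (r : seq I) (h : I -> R[i]) :
  IM (\sum_(i <- r) h i) = \sum_(i <- r) IM (h i).
Proof. by elim/big_rec2: _ => [|i a b _ <-]; rewrite ?ImD. Qed.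

Lemma continuous_sumr (T : topologicalType) I (r : seq I) (h : I -> T -> R) :
  (forall i, continuous (h i)) -> continuous (fun x => \sum_(i <- r) h i x).
Proof.
move=> hc; elim: r => [|i r IH] x.
  have -> : (fun x => \sum_(i <- [::]) h i x) = cst 0 by apply/funext => y; rewrite big_nil.
  exact: cvg_cst.
have -> : (fun x => \sum_(j <- i :: r) h j x) = (h i \+ (fun x => \sum_(j <- r) h j x)).
  by apply/funext => y; rewrite big_cons.
by apply: continuousD; [exact: hc | exact: IH].
Qed.

Lemma continuous_mulr_fun (T : topologicalType) (g h : T -> R) :
  continuous g -> continuous h -> continuous (fun x => g x * h x).
Proof. by move=> gc hc x; apply: continuousM; [exact: gc | exact: hc]. Qed.

Lemma continuous_quadratic m (c : 'I_m -> 'I_m -> R) :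
  continuous (fun u : 'rV[R]_m => \sum_k \sum_l u 0 k * u 0 l * c k l).
Proof.
apply: continuous_sumr => k; apply: continuous_sumr => l.
apply: continuous_mulr_fun; last by exact: cst_continuous.
by apply: continuous_mulr_fun; exact: coord_continuous.
Qed.

Lemma continuous_Re_form B m (f : 'I_m -> H) : sesqui_form B ->
  continuous (fun u => RE (B (real_comb f u) (real_comb f u))).
Proof.
move=> sB; have -> : (fun u => RE (B (real_comb f u) (real_comb f u))) =
    (fun u : 'rV[R]_m => \sum_k \sum_l u 0 k * u 0 l * RE (B (f k) (f l))); last first.
  exact: continuous_quadratic.
apply/funext => u; rewrite sesqui_real_comb // Re_sum; apply: eq_bigr => k _.
by rewrite Re_sum; apply: eq_bigr => l _; rewrite !ReImE; ring.
Qed.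

Lemma continuous_Im_form B m (f : 'I_m -> H) : sesqui_form B ->
  continuous (fun u => IM (B (real_comb f u) (real_comb f u))).
Proof.
move=> sB; have -> : (fun u => IM (B (real_comb f u) (real_comb f u))) =
    (fun u : 'rV[R]_m => \sum_k \sum_l u 0 k * u 0 l * IM (B (f k) (f l))); last first.
  exact: continuous_quadratic.
apply/funext => u; rewrite sesqui_real_comb // Im_sum; apply: eq_bigr => k _.
by rewrite Im_sum; apply: eq_bigr => l _; rewrite !ReImE; ring.
Qed.

Variables (N : H -> H -> R[i]) (sN : sesqui_form N) (pN : psd N).
Variables (m : nat) (f : 'I_m -> H).
Hypothesis f_pos : forall u, u != 0 -> 0 < qform N (real_comb f u).
Hypothesis f_onto : forall x, exists u, qform N (x - real_comb f u) = 0.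

(** These functions factor through the quotient by the null space of [N] and are determined, off
    that null space, by their values on the coordinate sphere. *)
Record regular (k : nat) F : Prop := Regular {
  regular_continuous : continuous (fun u => F (real_comb f u));
  regularZ : forall (r : R) x, 0 < r -> F (r%:C%C *: x) = r ^+ k * F x;
  regular_null : forall x z, qform N z = 0 -> F (x + z) = F x }.

Definition compatible B :=
  forall z, qform N z = 0 -> forall x, B z x = 0 /\ B x z = 0.

Lemma compatible_null B x z : sesqui_form B -> compatible B -> qform N z = 0 ->
  B (x + z) (x + z) = B x x.
Proof.
move=> sB cB z0; have [h _] := cB z z0 z; have [h1 h2] := cB z z0 x.
by rewrite !(sesquiDl sB, sesquiDr sB) h h1 h2 !addr0.
Qed.

Lemma sesqui_realZ B (r : R) x : sesqui_form B ->
  B (r%:C%C *: x) (r%:C%C *: x) = (r ^+ 2)%:C%C * B x x.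
Proof.
by move=> sB; rewrite (sesquiZl sB) (sesquiZr sB); apply: eqRI; rewrite !ReImE; ring.
Qed.

Lemma regular_Re B :
  sesqui_form B -> compatible B -> regular 2 (fun x => RE (B x x)).
Proof.
move=> sB cB; split; first exact: continuous_Re_form.
- by move=> r x _; rewrite sesqui_realZ // !ReImE; ring.
- by move=> x z z0; rewrite compatible_null.
Qed.

Lemma regular_Im B :
  sesqui_form B -> compatible B -> regular 2 (fun x => IM (B x x)).
Proof.
move=> sB cB; split; first exact: continuous_Im_form.
- by move=> r x _; rewrite sesqui_realZ // !ReImE; ring.
- by move=> x z z0; rewrite compatible_null.
Qed.

Lemma regularM j k F G : regular j F -> regular k G ->
  regular (j + k) (fun x => F x * G x).
Proof.
move=> [Fc FZ F0] [Gc GZ G0]; split.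
- by move=> u; apply: continuousM; [exact: Fc | exact: Gc].
- by move=> r x r0; rewrite FZ // GZ // exprD; ring.
- by move=> x z z0; rewrite F0 // G0.
Qed.

Lemma regularD k F G : regular k F -> regular k G ->
  regular k (fun x => F x + G x).
Proof.
move=> [Fc FZ F0] [Gc GZ G0]; split.
- by move=> u; apply: continuousD; [exact: Fc | exact: Gc].
- by move=> r x r0; rewrite FZ // GZ //; ring.
- by move=> x z z0; rewrite F0 // G0.
Qed.

Lemma qform_null_eq x u : qform N (x - real_comb f u) = 0 ->
  forall k F, regular k F -> F (real_comb f u) = F x.
Proof.
by move=> x0 k F rF; rewrite -[in RHS](subrK (real_comb f u) x) [in RHS]addrC (regular_null rF).
Qed.

Lemma regular_N : regular 2 (qform N).
Proof. by apply: regular_Re => // z z0; apply: psd_null. Qed.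

Lemma real_comb0 : real_comb f 0 = 0.
Proof. by rewrite /real_comb big1 // => k _; rewrite mxE scale0r. Qed.

Lemma qform0 : qform N 0 = 0.
Proof. by rewrite /qform; have [-> _] := sesqui0 0 sN. Qed.

(** [x] agrees modulo the null space with a combination of the frame; its coordinates are divided by
    their norm, which becomes [r]. *)
Lemma sphere_repr x : 0 < qform N x -> exists u (r : R),
  [/\ `|u| = 1, 0 < r & forall k F, regular k F -> F x = r ^+ k * F (real_comb f u)].
Proof.
move=> x0; have [u xu] := f_onto x.
have u0 : u != 0.
  by apply: contraTneq x0 => u0; rewrite -(qform_null_eq xu regular_N) u0 real_comb0 qform0 ltxx.
have nu0 : 0 < `|u| by rewrite normr_gt0.
exists (`|u|^-1 *: u), `|u|; split => //.
  by rewrite normrZ normfV normr_id mulVf ?gt_eqF.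
move=> k F rF; rewrite -(qform_null_eq xu rF) -(regularZ rF) // -real_combZ scalerA.
by rewrite mulfV ?gt_eqF // scale1r.
Qed.

(** The quotient of [F] by [qform N ^+ j] has degree 0, and the constraint on [G] is closed and
    invariant under positive scaling. A minimum over the compact part of the sphere where the
    constraint holds is therefore global; the minimizer is rescaled at the end. *)
Lemma regular_min j k F G x1 : regular j.*2 F -> regular k G ->
  0 < qform N x1 -> G x1 <= 0 ->
  exists x0, [/\ qform N x0 = 1, G x0 <= 0 & forall x, 0 < qform N x ->
    G x <= 0 -> F x0 * qform N x ^+ j <= F x].
Proof.
move=> rF rG x10 G1.
pose phi := real_comb f.
pose K := ([set u | `|u| = 1] `&` [set u | G (phi u) <= 0])%classic.
have Kpos u : K u -> 0 < qform N (phi u).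
  by move=> [/= u1 _]; apply: f_pos; rewrite -normr_gt0 u1.
have K0 : (K !=set0)%classic.
  have [u [r [u1 r0 h]]] := sphere_repr x10; exists u; split => //=.
  by move: G1; rewrite (h _ _ rG) pmulr_rle0 // exprn_gt0.
have cK : compact K.
  apply: bounded_closed_compact.
    by exists 1; split => // M M1 u [/= -> _]; exact: ltW.
  apply: closedI.
    apply: (@preimage_closed _ _ (fun u : 'rV[R]_m => `|u|) [set x | x = 1]%classic).
      by move=> u _; exact: norm_continuous.
    exact: closed_eq.
  apply: (@preimage_closed _ _ (fun u => G (phi u)) [set x | x <= 0]%classic).
    by move=> u _; exact: (regular_continuous rG).
  exact: closed_le.
have [|u0 /set_mem Ku0 umin] :=
  @EVT_min_rV R m (fun u => F (phi u) / qform N (phi u) ^+ j) K K0 cK.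
  apply: continuous_in_subspaceT => u /set_mem Ku.
  have cV : {for u, continuous (fun u => (qform N (phi u) ^+ j)^-1)}.
    apply: (@continuousV _ _ (fun u => qform N (phi u) ^+ j)).
      by rewrite expf_neq0 // gt_eqF // Kpos.
    apply: (@continuous_comp _ _ _ (fun u => qform N (phi u)) (fun y : R => y ^+ j)).
      exact: (regular_continuous regular_N).
    exact: exprn_continuous.
  have cF : {for u, continuous (fun u => F (phi u))} by exact: (regular_continuous rF).
  exact: (continuousM cF cV).
have N0 := Kpos _ Ku0.
pose s := (Num.sqrt (qform N (phi u0)))^-1.
have s0 : 0 < s by rewrite invr_gt0 sqrtr_gt0.
have s2 : s ^+ 2 = (qform N (phi u0))^-1 by rewrite exprVn sqr_sqrtr // ltW.
exists (s%:C%C *: phi u0); split.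
- by rewrite (regularZ regular_N) // s2 mulVf // gt_eqF.
- by rewrite (regularZ rG) // pmulr_rle0 ?exprn_gt0 //; case: Ku0.
move=> x x0 Gx; have [u [r [u1 r0 h]]] := sphere_repr x0.
have Ku : K u by split => //=; move: Gx; rewrite (h _ _ rG) pmulr_rle0 // exprn_gt0.
rewrite (regularZ rF) // (h _ _ rF) (h _ _ regular_N) exprMn -exprM mul2n.
have := umin u (mem_set Ku).
rewrite -[in s ^+ _]mul2n exprM s2 exprVn [_^-1 * _]mulrC => le.
have := ler_wpM2r (ltW (exprn_gt0 j (Kpos _ Ku))) le.
rewrite divfK; last by rewrite expf_neq0 // gt_eqF // Kpos.
by move=> le2; rewrite mulrCA ler_pM2l ?exprn_gt0.
Qed.

End Compactness.

(** * The semi-inner product of [A] and attainment of the operator seminorm *)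

Section Operators.
Variables (R : realType) (H : vectType R[i]).
Variables (dot : {dot H for conjC}) (A : 'End(H)).
Hypothesis A_pos : positive_op dot A.
Implicit Types T S P Q : 'End(H).
Local Notation N := (dotA dot A).

Lemma sesqui_dotA P Q : sesqui_form (fun x y => N (P x) (Q y)).
Proof.
split=> [x y z|x y z|c x y|c x y]; rewrite /dotA.
- by rewrite !linearD linearDl.
- by rewrite linearD linearDr.
- by rewrite !linearZ /= linearZl_LR.
- by rewrite linearZ /= linearZr_LR.
Qed.

Lemma sesqui_N : sesqui_form N.
Proof.
split=> [x y z|x y z|c x y|c x y]; rewrite /dotA.
- by rewrite linearD linearDl.
- by rewrite linearDr.
- by rewrite linearZ /= linearZl_LR.
- by rewrite linearZr_LR.
Qed.

Lemma psd_N : psd N. Proof. exact: A_pos. Qed.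

Lemma normA_sqr x : normA dot A x ^+ 2 = qform N x.
Proof. by rewrite sqr_sqrtr // (psd_qform_ge0 _ psd_N). Qed.

(** A null vector is orthogonal to everything for the form; testing against [A z] gives |A z|^2 =
    0. *)
Lemma qformN_null z : qform N z = 0 -> A z = 0.
Proof.
move=> z0; apply/eqP; rewrite -(dnorm_eq0 dot); apply/eqP.
by have [] := psd_null sesqui_N psd_N z0 (A z).
Qed.

Lemma qformN_ker z : A z = 0 -> qform N z = 0.
Proof. by move=> z0; rewrite /qform /dotA z0 linear0l. Qed.

(** Writing x = A z, the square |x|^2 is the form at [z] and the null vector [x], hence 0. *)
Lemma limg_lker x : x \in limg A -> A x = 0 -> x = 0.
Proof.
move=> /memv_imgP[z _ xE] Ax; apply/eqP; rewrite -(dnorm_eq0 dot); apply/eqP.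
rewrite {1}xE; have [_] := psd_null sesqui_N psd_N (qformN_ker Ax) z; exact.
Qed.

(** Range and kernel of [A] meet in 0, so by rank-nullity they span [H]; the range component of [x]
    is the representative. *)
Lemma limg_repr x : exists2 y, y \in limg A & qform N (x - y) = 0.
Proof.
have cap0 : (limg A :&: lker A = 0)%VS.
  apply/eqP; rewrite -subv0; apply/subvP => y; rewrite memv_cap memv_ker.
  by move=> /andP[y1 /eqP y2]; rewrite memv0 (limg_lker y1 y2).
have full : (limg A + lker A = fullv)%VS.
  apply/eqP; rewrite eqEdim subvf /= dimv_disjoint_sum // addnC.
  by have := limg_ker_dim A fullv; rewrite capfv => ->.
have /memv_addP[y yA [z zA ->]] : x \in (limg A + lker A)%VS by rewrite full memvf.
exists y => //; rewrite addrC addKr; apply: qformN_ker; apply/eqP.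
by rewrite -memv_ker.
Qed.

(** A basis of the range over the reals: the complex basis vectors followed by their multiples by
    i. *)
Definition limg_frame (k : 'I_(\dim (limg A) + \dim (limg A))) : H :=
  match fintype.split k with
  | inl j => (vbasis (limg A))`_j
  | inr j => 'i%C *: (vbasis (limg A))`_j
  end.

Lemma limg_frameE u : real_comb limg_frame u =
  \sum_j Complex (u 0 (lshift _ j)) (u 0 (rshift _ j)) *: (vbasis (limg A))`_j.
Proof.
rewrite /real_comb big_split_ord /= -big_split /=; apply: eq_bigr => j _.
have -> : limg_frame (lshift _ j) = (vbasis (limg A))`_j.
  by rewrite /limg_frame (unsplitK (inl j)).
have -> : limg_frame (rshift _ j) = 'i%C *: (vbasis (limg A))`_j.
  by rewrite /limg_frame (unsplitK (inr j)).
rewrite scalerA -scalerDl; congr (_ *: _).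
by apply: eqRI; rewrite !ReImE !(mulr0, mul0r, mulr1, addr0, add0r, subr0).
Qed.

Lemma limg_frame_pos u : u != 0 -> 0 < qform N (real_comb limg_frame u).
Proof.
apply: contraTT; rewrite -leNgt => le0.
have /qformN_null A0 : qform N (real_comb limg_frame u) = 0.
  by apply/eqP; rewrite eq_le le0 (psd_qform_ge0 _ psd_N).
have /limg_lker/(_ A0) : real_comb limg_frame u \in limg A.
  rewrite limg_frameE; apply: rpred_sum => j _; apply: rpredZ.
  by apply: vbasis_mem; rewrite mem_nth // size_tuple.
rewrite limg_frameE => /(congr1 (fun v => coord (vbasis (limg A)) ^~ v)) co.
have fr := basis_free (vbasisP (limg A)).
have c0 j : Complex (u 0 (lshift _ j)) (u 0 (rshift _ j)) = 0 :> R[i].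
  by have := congr1 (fun h => h j) co; rewrite coord_sum_free // linear0.
rewrite negbK; apply/eqP/rowP => k; rewrite mxE.
rewrite -(splitK k); case: (fintype.split k) => j /=; have := c0 j; last by case.
by case.
Qed.

Lemma limg_frame_onto x : exists u, qform N (x - real_comb limg_frame u) = 0.
Proof.
have [y yA xy] := limg_repr x.
pose c j := coord (vbasis (limg A)) j y.
exists (row_mx (\row_j RE (c j)) (\row_j IM (c j))); rewrite limg_frameE.
rewrite -[X in x - X](_ : y = _) //.
rewrite {1}(coord_vbasis yA); apply: eq_bigr => j _; congr (_ *: _).
by rewrite row_mxEl row_mxEr !mxE /c; case: (coord _ _ _).
Qed.

(** This lets [T] act on the quotient by the null space, which makes the forms built from it
    compatible with [N]. *)
Definition null_stable T := forall z, qform N z = 0 -> qform N (T z) = 0.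

Lemma boundedA_null_stable T : boundedA dot A T -> null_stable T.
Proof.
move=> [c c0 Tc] z z0; apply/eqP; rewrite -normA_sqr sqrf_eq0.
have := Tc z; rewrite {2}/normA -/(qform N z) z0 sqrtr0 mulr0 => le0.
by rewrite eq_le le0 sqrtr_ge0.
Qed.

Lemma null_stableD T S c :
  null_stable T -> null_stable S -> null_stable (T + c *: S).
Proof.
move=> Tn Sn z z0; apply: qformN_ker.
rewrite add_lfunE scale_lfunE linearD linearZ /=.
by rewrite (qformN_null (Tn z z0)) (qformN_null (Sn z z0)) scaler0 addr0.
Qed.

Lemma null_stable_compatible P Q : null_stable P -> null_stable Q ->
  compatible N (fun x y => N (P x) (Q y)).
Proof.
move=> Pn Qn z z0 x; split.
  by have [] := psd_null sesqui_N psd_N (Pn z z0) (Q x).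
by have [] := psd_null sesqui_N psd_N (Qn z z0) (P x).
Qed.

Local Notation regN := (regular N limg_frame).

Lemma regular_form_Re P Q : null_stable P -> null_stable Q ->
  regN 2 (fun x => RE (N (P x) (Q x))).
Proof.
move=> Pn Qn; apply: (@regular_Re _ _ _ _ _ (fun x y => N (P x) (Q y))).
  exact: sesqui_dotA.
exact: null_stable_compatible.
Qed.

Lemma regular_form_Im P Q : null_stable P -> null_stable Q ->
  regN 2 (fun x => IM (N (P x) (Q x))).
Proof.
move=> Pn Qn; apply: (@regular_Im _ _ _ _ _ (fun x y => N (P x) (Q y))).
  exact: sesqui_dotA.
exact: null_stable_compatible.
Qed.

Lemma regular_cst0 k : regN k (fun=> 0).
Proof. by split=> [||//]; [exact: cst_continuous | move=> *; rewrite mulr0]. Qed.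

Lemma regular_scale k (c : R) F : regN k F -> regN k (fun x => c * F x).
Proof.
move=> [Fc FZ F0]; split.
- apply: continuous_mulr_fun; [exact: cst_continuous | exact: Fc].
- by move=> r x r0; rewrite FZ //; ring.
- by move=> x z z0; rewrite F0.
Qed.

Definition form_min j k :=
  @regular_min _ _ _ sesqui_N psd_N _ _ limg_frame_pos limg_frame_onto j k.

Hypothesis A_neq0 : A != 0.

Lemma exists_qformN_gt0 : exists x, 0 < qform N x.
Proof.
have [//|no] := pselect (exists x, 0 < qform N x).
case/eqP: A_neq0; apply/lfunP => x; rewrite zero_lfunE; apply: qformN_null.
apply/eqP; rewrite eq_le (psd_qform_ge0 _ psd_N) andbT leNgt; apply/negP => x0.
by apply: no; exists x.
Qed.

(** Minimization under the constant constraint 0. At null vectors [F] equals [F 0], and homogeneity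
    with factor 2 forces [F 0 = 0]. *)
Lemma qformN_scaled_bound (F : H -> R) : regN 2 F ->
  exists2 x0, qform N x0 = 1 & forall x, F x0 * qform N x <= F x.
Proof.
move=> rF; have [x1 x10] := exists_qformN_gt0.
have [x0 [N0 _ h]] := form_min (j := 1) rF (regular_cst0 0) x10 (lexx 0).
exists x0 => // x; have := psd_qform_ge0 x psd_N.
rewrite le_eqVlt => /orP[/eqP x_0|x_0]; last by have := h x x_0 (lexx 0).
have := regular_null rF 0 (esym x_0); rewrite add0r -x_0 mulr0 => ->.
have := regularZ rF 0 (ltr0n _ 2); rewrite scaler0 => F0.
have : F 0 = 2 ^+ 2 * F 0 := F0. lra.
Qed.

(** Minimizing minus the squared seminorm of [T x] yields a maximizer, whose value is then
    identified with the supremum. *)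
Lemma opnormA_attained T : null_stable T ->
  exists2 x0, norm_attainA dot A T x0 &
    forall x, qform N (T x) <= opnormA dot A T ^+ 2 * qform N x.
Proof.
move=> Tn; have [x0 N0 h] :=
  qformN_scaled_bound (regular_scale (-1) (regular_form_Re Tn Tn)).
have {}h x : qform N (T x) <= qform N (T x0) * qform N x.
  by have := h x; rewrite mulN1r mulNr mulN1r lerN2.
have nx0 : normA dot A x0 = 1 by rewrite /normA -/(qform N x0) N0 sqrtr1.
suff opE : opnormA dot A T = normA dot A (T x0).
  by exists x0; rewrite ?opE ?normA_sqr.
have ub y : normA dot A (T y) / normA dot A y <= normA dot A (T x0).
  (* Division by 0 gives 0, so null vectors do not affect the bound. *)
  have [->|ny] := eqVneq (normA dot A y) 0; first by rewrite invr0 mulr0 sqrtr_ge0.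
  have ny0 : 0 < normA dot A y by rewrite lt_def ny sqrtr_ge0.
  rewrite ler_pdivrMr // -ler_sqr ?nnegrE ?mulr_ge0 ?sqrtr_ge0 //.
  by rewrite exprMn !normA_sqr.
(* The supremum only sees nonzero vectors of the closed range, so the maximizer is replaced by a
   range vector congruent to it modulo the null space. *)
have [y yA xy] := limg_repr x0.
have reg2 F : regN 2 F -> F y = F x0.
  by move=> rF; rewrite -(regular_null rF y xy) addrC subrK.
have Ny : normA dot A y = 1.
  by rewrite /normA -/(qform N y) (reg2 _ (regular_N sesqui_N psd_N _)) N0 sqrtr1.
have Ty : normA dot A (T y) = normA dot A (T x0).
  by rewrite /normA (reg2 _ (regular_form_Re Tn Tn)).
have yS : closure_range dot A y /\ y != 0.
  split; last first.
    apply/eqP => y0; move: Ny; rewrite y0 /normA /dotA !linear0 sqrtr0.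
    by move/eqP; rewrite eq_sym oner_eq0.
  move=> e e0; have /memv_imgP[z _ yE] := yA; exists z.
  by rewrite yE subrr /norm_dot linear0l sqrtr0.
apply/eqP; rewrite eq_le; apply/andP; split.
  apply: ge_sup; last by move=> _ [z _ <-]; exact: ub.
  by exists (normA dot A (T y) / normA dot A y); exists y.
rewrite -Ty -[leLHS]divr1 -Ny; apply: ub_le_sup; last by exists y.
by exists (normA dot A (T x0)) => _ [z _ <-]; exact: ub.
Qed.

End Operators.

(** * The two implications *)

Section BirkhoffJames.
Variables (R : realType) (H : vectType R[i]).
Variables (dot : {dot H for conjC}) (A : 'End(H)).
Hypotheses (A_pos : positive_op dot A) (A_neq0 : A != 0).
Variables (T S : 'End(H)).
Hypotheses (Tn : null_stable dot A T) (Sn : null_stable dot A S).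
Local Notation N := (dotA dot A).
Local Notation regN := (regular N (@limg_frame _ _ A)).

Lemma qform_pencil (g : R[i]) x : qform N ((T + g *: S) x) =
  qform N (T x) + 2 * RE (g^* * N (T x) (S x)) + sqmod g * qform N (S x).
Proof.
have sN := sesqui_N dot A; have pN := psd_N A_pos.
rewrite add_lfunE scale_lfunE /= {1}/qform sesqui_expand //.
rewrite (psd_herm sN pN (T x) (S x)) (psd_real (S x) pN) !ReImE /sqmod /qform; ring.
Qed.

(** Pythagoras at [x]: the cross term vanishes, so adding [g *: S] cannot shrink the image of
    [x]. *)
Lemma perp_bj x : norm_attainA dot A T x -> perpA dot A (T x) (S x) ->
  bj_perpA dot A T S.
Proof.
move=> [nx nT] perp g.
have [_ _ h] := opnormA_attained A_pos A_neq0 (null_stableD A_pos g Tn Sn).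
have op0 : 0 <= opnormA dot A (T + g *: S).
  have [y [_ <-] _] := opnormA_attained A_pos A_neq0 (null_stableD A_pos g Tn Sn).
  exact: sqrtr_ge0.
rewrite -ler_sqr ?nnegrE // -?nT ?sqrtr_ge0 // normA_sqr //.
have := h x; rewrite -(normA_sqr A_pos x) nx expr1n mulr1; apply: le_trans.
rewrite qform_pencil; have -> : N (T x) (S x) = 0 by [].
rewrite mulr0 mulr0 addr0 lerDl mulr_ge0 ?addr_ge0 ?sqr_ge0 //.
exact: (psd_qform_ge0 _ (psd_N A_pos)).
Qed.

(** The inverse of a sum dominating both requirements. The first bound tames the quadratic term in
    [t], the second keeps the perturbation below the gap [d]. *)
Lemma exists_small_step (s d k p : R) : 0 <= s -> 0 < d -> 0 <= k -> 0 < p ->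
  exists2 t, 0 < t & t * s <= 1 /\ t * (2 * k + p) < d.
Proof.
move=> s0 d0 k0 p0; pose t := (1 + s + (2 * k + p) / d)^-1.
have q0 : 0 < (2 * k + p) / d by apply: divr_gt0; lra.
have t0 : 0 < t by rewrite invr_gt0; lra.
have tE : t * (1 + s + (2 * k + p) / d) = 1 by rewrite mulVf // gt_eqF //; lra.
have ts : 0 <= t * s by rewrite mulr_ge0 // ltW.
have tq : 0 <= t * ((2 * k + p) / d) by rewrite mulr_ge0 // ltW.
exists t => //; split; first lra.
rewrite -[ltRHS]mul1r -ltr_pdivrMr // -mulrA; lra.
Qed.

Lemma bj_perp : bj_perpA dot A T S ->
  exists2 x, norm_attainA dot A T x & perpA dot A (T x) (S x).
Proof.
have sN := sesqui_N dot A; have pN := psd_N A_pos; move=> bj.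
have [xT [nxT nTxT] hT] := opnormA_attained A_pos A_neq0 Tn.
have [_ _ hS] := opnormA_attained A_pos A_neq0 Sn.
pose lam := opnormA dot A T ^+ 2; pose b x y := N (T x) (S y).
pose a x y := N (T x) (T y).
pose D x y := lam%:C%C * N x y - a x y.
pose F x := qform D x.
have FE x : F x = lam * qform N x - qform N (T x).
  by rewrite /F /qform /D /a !ReImE; ring.
have sa : sesqui_form a := sesqui_dotA dot A T T.
have sb : sesqui_form b := sesqui_dotA dot A T S.
have sD : sesqui_form D.
  case: sN sa => [a1 a2 a3 a4] [b1 b2 b3 b4]; split=> *;
    rewrite /D ?(a1,a2,a3,a4,b1,b2,b3,b4); ring.
have pD : psd D.
  move=> x; rewrite lecE -[RE (D x x)]/(F x) FE subr_ge0 hT andbT.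
  rewrite /D /a !ReImE (psd_Im x pN) (psd_Im (T x) pN); apply/eqP; ring.
have rN : regN 2 (qform N) := regular_N sN pN _.
have rF : regN 2 F.
  have -> : F = fun x => lam * qform N x + (-1) * qform N (T x).
    by apply/funext => x; rewrite FE; ring.
  apply: regularD; apply: regular_scale => //; exact: regular_form_Re.
have rRe : regN 2 (fun x => RE (b x x)) by exact: regular_form_Re.
have rIm : regN 2 (fun x => IM (b x x)) by exact: regular_form_Im.
have r4 : regN 4 (fun x => sqmod (b x x)).
  have -> : (fun x => sqmod (b x x)) =
      fun x => RE (b x x) * RE (b x x) + IM (b x x) * IM (b x x).
    by apply/funext => x; rewrite /sqmod !expr2.
  by apply: regularD; apply: (regularM (j := 2) (k := 2)).
have NxT : qform N xT = 1 by rewrite -normA_sqr // nxT expr1n.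
have FxT : F xT <= 0 by rewrite FE NxT -(normA_sqr A_pos (T xT)) nTxT /lam; lra.
have NxT0 : 0 < qform N xT by rewrite NxT.
(* Since [F] is nonnegative, the constraint [F <= 0] describes the set M; degree 4 of |b|^2 calls
   for [j = 2]. *)
have [x0 [Nx0 Fx0 min]] := form_min (j := 2) A_pos r4 rF NxT0 FxT.
have F0 x : F x <= 0 -> F x = 0.
  by move=> Fx; apply/eqP; rewrite eq_le Fx (psd_qform_ge0 _ pD).
have [w0|w0] := eqVneq (b x0 x0) 0.
  exists x0 => //; split; first by rewrite /normA -/(qform N x0) Nx0 sqrtr1.
  apply/eqP; rewrite -(eqrXn2 (n := 2)) ?sqrtr_ge0 //; last first.
    by rewrite -nTxT sqrtr_ge0.
  by rewrite normA_sqr //; have := F0 _ Fx0; rewrite FE Nx0 mulr1 => /eqP;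
    rewrite subr_eq0 eq_sym.
exfalso; set w := b x0 x0 in w0.
pose d := sqmod w.
have d0 : 0 < d.
  rewrite lt_def addr_ge0 ?sqr_ge0 // andbT; apply: contra w0.
  rewrite paddr_eq0 ?sqr_ge0 // !sqrf_eq0 => /andP[/eqP r0 /eqP i0].
  by apply/eqP/eqRI.
pose h x := RE (w^* * b x x).
have hE x : F x <= 0 -> d * qform N x <= h x.
  (* M is a subspace: adding a null vector of [D] leaves [F] unchanged, so the complex line from
     [x0] along [x] stays in M. *)
  move=> Fx; apply: (@min_sqmod_Re _ _ _ _ _ _ (fun y => F y <= 0)) => // [c|y Fy].
    rewrite /F (psd_nullD sD pD) //; apply/eqP.
    rewrite qformZ //; have [-> _] := psd_null sD pD (F0 _ Fx) x.
    by rewrite mulr0.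
  have := psd_qform_ge0 y pN; rewrite le_eqVlt => /orP[/eqP <-|]; last by move/min; apply.
  by rewrite expr0n mulr0 addr_ge0 ?sqr_ge0.
have rh : regN 2 h.
  have -> : h = fun x => RE w * RE (b x x) + IM w * IM (b x x).
    by apply/funext => x; rewrite /h !ReImE; ring.
  by apply: regularD; apply: regular_scale.
have [k hk] : exists k, forall x, k * qform N x <= h x.
  by have [y _ hy] := qformN_scaled_bound A_pos A_neq0 rh; exists (h y).
(* [G <= 0] cuts out a closed region away from M, because on M [h] is at least [d * qform N], twice
   the threshold. *)
pose G x := h x + (- (d / 2)) * qform N x.
have rG : regN 2 G by apply: regularD => //; exact: regular_scale.
have [e e0 He] : exists2 e, 0 < e &
    forall x, 0 < qform N x -> G x <= 0 -> e * qform N x <= F x.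
  (* [e] is the minimum of [F] over the A-unit vectors of this region, positive by [hE]; if the
     region is empty, any [e] will do. *)
  have [[x1 [Nx1 Gx1]]|no] := pselect (exists x1, 0 < qform N x1 /\ G x1 <= 0); last first.
    by exists 1 => // x Nx Gx; case: no; exists x.
  have [y [Ny Gy hy]] := form_min (j := 1) A_pos rF rG Nx1 Gx1.
  exists (F y) => //; rewrite ltNge; apply/negP => /hE.
  by move: Gy; rewrite /G Ny; lra.
pose s := opnormA dot A S ^+ 2.
have [t t0 [ts tk]] := exists_small_step (sqr_ge0 _ : 0 <= s) e0 (normr_ge0 k) d0.
(* Testing at a vector where the seminorm of T - t w S is attained reduces the contradiction to one
   inequality at [y]. *)
have [y [ny nTy] _] :=
  opnormA_attained A_pos A_neq0 (null_stableD A_pos (- (t%:C%C * w)) Tn Sn).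
have Ny : qform N y = 1 by rewrite -normA_sqr // ny expr1n.
have opT0 : 0 <= opnormA dot A T by rewrite -nTxT sqrtr_ge0.
have := bj (- (t%:C%C * w)); rewrite -nTy -ler_sqr ?nnegrE ?sqrtr_ge0 //.
rewrite normA_sqr // qform_pencil -/lam.
have -> : RE ((- (t%:C%C * w))^* * N (T y) (S y)) = - (t * h y).
  by rewrite /h /b !ReImE; ring.
have -> : sqmod (- (t%:C%C * w)) = t ^+ 2 * d by rewrite /d /sqmod !ReImE; ring.
have Fy := FE y; rewrite Ny mulr1 in Fy.
have Sy := hS y; rewrite -/s Ny mulr1 in Sy.
have ky := hk y; rewrite Ny mulr1 in ky.
have td : 0 < t * d by rewrite mulr_gt0.
have cS : t ^+ 2 * d * qform N (S y) <= t * d.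
  apply: (@le_trans _ _ (t * d * (t * s))); last by rewrite -[leRHS]mulr1 ler_pM2l.
  have -> : t ^+ 2 * d * qform N (S y) = t * d * (t * qform N (S y)) by ring.
  by rewrite ler_pM2l // ler_pM2l.
have FN : 0 <= F y := psd_qform_ge0 y pD.
(* Away from M the gap [F y >= e] exceeds the total perturbation 2 t |k| + t d. Otherwise the linear
   gain 2 t h y exceeds t d, which bounds the quadratic term. *)
have [Gy|Gy] := leP (G y) 0.
  have := He y; rewrite Ny mulr1 => /(_ ltr01 Gy) ey.
  have tkh : t * (- `|k|) <= t * h y.
    by rewrite ler_pM2l //; apply: le_trans ky; rewrite lerNl ler_normr lexx orbT.
  lra.
have : t * (d / 2) < t * h y by rewrite ltr_pM2l //; move: Gy; rewrite /G Ny; lra.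
lra.
Qed.

End BirkhoffJames.

(** For [A = 0] no vector has A-norm one, so the first condition fails while the second holds with
    all operator seminorms 0; [A_neq0] excludes this case. *)
Theorem theorem2p4 (R : realType) (H : vectType R[i])
    (dot : {dot H for conjC}) (A : 'End(H))
    (A_pos : positive_op dot A) (A_neq0 : A != 0)
    (T S : 'End(H)) (T_bd : boundedA dot A T) (S_bd : boundedA dot A S) :
  (exists2 x : H, norm_attainA dot A T x & perpA dot A (T x) (S x)) <->
  bj_perpA dot A T S.
Proof.
have Tn := boundedA_null_stable A_pos T_bd.
have Sn := boundedA_null_stable A_pos S_bd.
split; first by case=> x; exact: perp_bj.
exact: bj_perp.
Qed.
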